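(* For an SCC $F:\Theta\to 2^Z\setminus\{\emptyset\}$ the following are equivalent: (i) $F$ is mixed-Nash-A-implementable; (ii) $F$ is mixed-Nash-B-implementable; (iii) $\widehat{\mathcal L}^{Y\text{-}A\text{-}B}$-uniform-monotonicity holds for $F$.
   Context: Standing setup: $\mathcal I=\{1,\dots,I\}$ finite, $I\ge 3$; $\Theta$ finite or countably infinite; $Z$ finite; $Y=\Delta(Z)$ with $z\in Z$ identified with degenerate lotteries; $u_i^\theta:Z\to\mathbb R$, $U_i^\theta(y)=\sum_zy_zu_i^\theta(z)$; $\mathcal L_i^Y(\alpha,\theta)=\{y\in Y:U_i^\theta(\alpha)\ge U_i^\theta(y)\}$, $\mathcal L_i^Z(\alpha,\theta)=\{z\in Z:U_i^\theta(\alpha)\ge u_i^\theta(z)\}$, and for nonempty $E\subseteq Z$, $\mathcal L_i^Z(E,\theta)=\bigcap_{z\in E}\mathcal L_i^Z(z,\theta)$. UNIF$(E)$ is the uniform lottery on $E$. Mechanisms, $PNE^{(\mathcal M,\theta)}$, $MNE^{(\mathcal M,\theta)}$ and induced lotteries $g(\lambda)$ are as usual (countable message sets, expected utility). Mixed-Nash-A-implementable: some $\mathcal M$ has $\bigcup_{\lambda\in MNE^{(\mathcal M,\theta)}}\mathrm{SUPP}(g[\lambda])=F(\theta)$ for all $\theta$; mixed-Nash-B-implementable: some $\mathcal M$ has $\bigcup_{\lambda\in MNE}\mathrm{SUPP}(g[\lambda])=\bigcup_{\lambda\in PNE}\mathrm{SUPP}(g[\lambda])=F(\theta)$ for all $\theta$.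 A nonempty $E\subseteq Z$ is an $i$-max set if for some $\theta$, $E\subseteq\arg\max_{z\in E}u_i^\theta(z)$ and $E\subseteq\arg\max_{z\in Z}u_j^\theta(z)$ for all $j\ne i$. $Z^*=\bigcup_\theta F(\theta)$ if $Z$ is an $i$-max set for some $i$, else $Z^*=Z$. A nonempty $E\subseteq Z^*$ is an $i$-$Z^*$-$\theta$-max set if $E\subseteq\arg\max_{z\in E}u_i^\theta(z)$ and $E\subseteq\arg\max_{z\in Z^*}u_j^\theta(z)$ for all $j\ne i$; $\Lambda^{i}(E)=\{\theta\in\Theta:E\text{ is an }i\text{-}Z^*\text{-}\theta\text{-max set}\}$ (empty if $E=\emptyset$), and $E$ is an $i$-$Z^*$-max set if $\Lambda^i(E)\neq\emptyset$. $\Theta_i^\theta=\{\theta'\in\Theta:F(\theta)\text{ is an }i\text{-}Z^*\text{-}\theta'\text{-max set and }F(\theta)\subseteq F(\theta')\}$. $\Xi_i(\theta)=\{K\subseteq\Theta_i^\theta,K\ne\emptyset:\Theta_i^\theta\cap\Lambda^i\big(Z^*\cap\mathcal L_i^Z(F(\theta),\theta)\cap\bigcap_{\theta'\in K}F(\theta')\big)=K\}$. Define $\widehat{\mathcal L}_i^{Y\text{-}A\text{-}B}(\mathrm{UNIF}[F(\theta)],\theta)=\Delta\big[Z^*\cap\mathcal L_i^Z(F(\theta),\theta)\cap\bigcup_{K\in\Xi_i(\theta)}\bigcap_{\theta'\in K}F(\theta')\big]$ if $F(\theta)\subseteq\arg\min_{z\in Z^*}u_i^\theta(z)$, $\Xi_i(\theta)\ne\emptyset$,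 and $Z^*\cap\mathcal L_i^Z(F(\theta),\theta)$ is an $i$-$Z^*$-max set; otherwise it equals $\Delta(Z^* )\cap\mathcal L_i^Y(\mathrm{UNIF}[F(\theta)],\theta)$. $\widehat{\mathcal L}^{Y\text{-}A\text{-}B}$-uniform-monotonicity holds if for all $\theta,\theta'\in\Theta$: [$\widehat{\mathcal L}_i^{Y\text{-}A\text{-}B}(\mathrm{UNIF}[F(\theta)],\theta)\subseteq\mathcal L_i^Y(\mathrm{UNIF}[F(\theta)],\theta')$ for all $i$] implies $F(\theta)\subseteq F(\theta')$. *)

(* Defs.v *)
From HB Require Import structures.
From mathcomp Require Import all_boot all_order all_algebra.
From mathcomp Require Import boolp classical_sets reals constructive_ereal ereal esum.
Unset Printing Implicit Defensive.
Import Order.TTheory GRing.Theory Num.Theory.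
Local Open Scope classical_set_scope.
Local Open Scope ring_scope.

Section Env.
Variables (R : realType) (n : nat) (Theta : countType) (Z : finType).
Variable u : Theta -> 'I_n -> Z -> R.
Variable F : Theta -> {set Z}.

Definition is_lottery (y : Z -> R) : Prop :=
  (forall z, 0 <= y z) /\ \sum_(z : Z) y z = 1.

Definition EU (i : 'I_n) (th : Theta) (y : Z -> R) : R :=
  \sum_(z : Z) y z * u th i z.

Definition unif (E : {set Z}) : Z -> R :=
  fun z => if z \in E then (#|E|%:R)^-1 else 0.

Definition Delta (E : {set Z}) : set (Z -> R) :=
  [set y | is_lottery y /\ forall z, z \notin E -> y z = 0].

Definition supp (y : Z -> R) : set Z := [set z | 0 < y z].

Definition lowerY (i : 'I_n) (th : Theta) (a : Z -> R) : set (Z -> R) :=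
  [set y | is_lottery y /\ EU i th y <= EU i th a].

(* L_i^Z(E, theta) = intersection over z in E of L_i^Z(z, theta)
   (z identified with the degenerate lottery, so U_i^theta(z) = u_i^theta(z)) *)
Definition lowerZset (i : 'I_n) (th : Theta) (E : {set Z}) : {set Z} :=
  [set z' | [forall z in E, u th i z' <= u th i z]]%SET.

Definition argmax_in (f : Z -> R) (E : {set Z}) : {set Z} :=
  [set z in E | [forall z' in E, f z' <= f z]]%SET.
Definition argmin_in (f : Z -> R) (E : {set Z}) : {set Z} :=
  [set z in E | [forall z' in E, f z <= f z']]%SET.

(* E is an i-W-theta-max set (W = [set: Z]%SET gives the plain notion) *)
Definition imax_th (W : {set Z}) (i : 'I_n) (th : Theta) (E : {set Z}) : bool :=
  [&& E != finset.set0, E \subset W, E \subset argmax_in (u th i) E &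
      [forall j : 'I_n, (j != i) ==> (E \subset argmax_in (u th j) W)]].

Definition imax_set (i : 'I_n) (E : {set Z}) : Prop :=
  exists th, imax_th [set: Z]%SET i th E.

Definition Zstar : {set Z} :=
  if `[< exists i, imax_set i [set: Z]%SET >]
  then [set z | `[< exists th, z \in F th >]]%SET
  else [set: Z]%SET.

Definition Lambda (i : 'I_n) (E : {set Z}) : set Theta :=
  [set th | imax_th Zstar i th E].

Definition iZstar_max (i : 'I_n) (E : {set Z}) : Prop := Lambda i E !=set0.

Definition ThetaI (i : 'I_n) (th : Theta) : set Theta :=
  [set th' | imax_th Zstar i th' (F th) /\ F th \subset F th'].

Definition bigcapF (K : set Theta) : {set Z} :=
  [set z | `[< forall th', K th' -> z \in F th' >]]%SET.

Definition Xi (i : 'I_n) (th : Theta) : set (set Theta) :=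
  [set K | K `<=` ThetaI i th /\ K !=set0 /\
     ThetaI i th `&` Lambda i (Zstar :&: lowerZset i th (F th) :&: bigcapF K) = K].

Definition hatL (i : 'I_n) (th : Theta) : set (Z -> R) :=
  if `[< F th \subset argmin_in (u th i) Zstar /\ Xi i th !=set0 /\
         iZstar_max i (Zstar :&: lowerZset i th (F th)) >]
  then Delta (Zstar :&: lowerZset i th (F th) :&:
              [set z | `[< exists K, Xi i th K /\ z \in bigcapF K >]]%SET)
  else Delta Zstar `&` lowerY i th (unif (F th)).

Definition hat_uniform_monotonicity : Prop :=
  forall th th' : Theta,
    (forall i : 'I_n, hatL i th `<=` lowerY i th' (unif (F th))) ->
    F th \subset F th'.

Record mechanism := Mechanism {
  msg : 'I_n -> countType;
  outc : (forall i, msg i) -> Z -> R;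
  outc_lottery : forall m, is_lottery (outc m) }.

Definition is_mixed (M : mechanism) (lam : forall i, msg M i -> R) : Prop :=
  forall i, (forall m, 0 <= lam i m) /\
            (\esum_(m in [set: msg M i]) (lam i m)%:E = 1%E).

Definition glot (M : mechanism) (lam : forall i, msg M i -> R) : Z -> R :=
  fun z => fine (\esum_(m in [set: forall i, msg M i])
                   ((\prod_(i < n) lam i (m i)) * @outc M m z)%:E).

Definition MNE (M : mechanism) (th : Theta) (lam : forall i, msg M i -> R) : Prop :=
  is_mixed M lam /\
  forall (i : 'I_n) (lam' : forall i, msg M i -> R), is_mixed M lam' ->
    (forall j, j != i -> lam' j = lam j) ->
    EU i th (glot M lam') <= EU i th (glot M lam).

Definition PNE (M : mechanism) (th : Theta) (m : forall i, msg M i) : Prop :=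
  forall (i : 'I_n) (m' : forall i, msg M i),
    (forall j, j != i -> m' j = m j) ->
    EU i th (@outc M m') <= EU i th (@outc M m).

Definition mixed_A_implementable : Prop :=
  exists M : mechanism, forall (th : Theta) (z : Z),
    z \in F th <-> exists lam, MNE M th lam /\ supp (glot M lam) z.

Definition mixed_B_implementable : Prop :=
  exists M : mechanism, forall (th : Theta) (z : Z),
    (z \in F th <-> exists lam, MNE M th lam /\ supp (glot M lam) z) /\
    (z \in F th <-> exists m, PNE M th m /\ supp (@outc M m) z).

End Env.

Arguments mixed_A_implementable {R n Theta Z} u F.
Arguments mixed_B_implementable {R n Theta Z} u F.
Arguments hat_uniform_monotonicity {R n Theta Z} u F.

(* Main.v *)
(* Necessity.  Let lam be an equilibrium at th; its outcome b is supported in F th.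
   Translating a deviation outcome y to unif (F th) + (y - b) / #|F th| puts it
   in the lower set of unif (F th), so the inclusion of lower sets in th' makes
   lam an equilibrium at th'.  When agent i's lower set is the reduced one, each
   outcome attainable by i is shown to lie in it: whenever these outcomes form an
   i-max set at th1, every unilateral deviation of i is an equilibrium at th1, so
   the outcomes lie in F th1; iterating this reaches a fixed point K in Xi.

   Sufficiency.  Each agent reports a state and an integer.  A consensus on
   (th, 0) yields unif (F th); a unique deviator i from it picks a lottery in
   hatL i th; otherwise the agent with the highest integer picks one in
   Delta Zstar.  A pick under the report (th', k) is nearly optimal at th', with
   weight 1 / (k + 1) on a lottery of sufficiently large support.  Letting k tend
   to infinity, in an equilibrium every profile played with positive probability
   gives each agent the supremum over the lotteries available to her against the
   others' messages, and the large support then forces the outcomes into F. *)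

Require Import Defs.
From mathcomp Require Import all_boot all_order all_algebra.
From mathcomp Require Import boolp classical_sets functions cardinality fsbigop.
From mathcomp Require Import reals constructive_ereal ereal esum.
From mathcomp Require Import ring lra.
From mathcomp Require Import finmap.

Set Implicit Arguments.
Unset Strict Implicit.
Unset Printing Implicit Defensive.
Import Order.TTheory GRing.Theory Num.Theory.
Local Open Scope classical_set_scope.
Local Open Scope ring_scope.

Arguments is_lottery {R Z} y.
Arguments EU {R n Theta Z} u i th y.
Arguments unif {R Z} E _.
Arguments Delta {R Z} E _.
Arguments supp {R Z} y _.
Arguments lowerY {R n Theta Z} u i th a _.
Arguments lowerZset {R n Theta Z} u i th E.
Arguments argmax_in {R Z} f E.
Arguments argmin_in {R Z} f E.
Arguments imax_th {R n Theta Z} u W i th E.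
Arguments Zstar {R n Theta Z} u F.
Arguments Lambda {R n Theta Z} u F i E _.
Arguments iZstar_max {R n Theta Z} u F i E.
Arguments ThetaI {R n Theta Z} u F i th _.
Arguments bigcapF {Theta Z} F K.
Arguments Xi {R n Theta Z} u F i th _.
Arguments hatL {R n Theta Z} u F i th _.
Arguments msg {R n Z} m0 _.
Arguments outc {R n Z} m0 _ _.
Arguments outc_lottery {R n Z} m0 m.
Arguments is_mixed {R n Z M} lam.
Arguments glot {R n Z M} lam _.
Arguments MNE {R n Theta Z} u M th lam.
Arguments PNE {R n Theta Z} u M th m.

(** * Countable sums and lotteries *)

Section Esum.
Context {R : realType} {T : choiceType}.
Local Open Scope ereal_scope.

Lemma esumZl (D : set T) (a : T -> \bar R) (c : R) :
  (forall t, 0 <= a t) -> (0 <= c)%R ->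
  \esum_(t in D) (c%:E * a t) = c%:E * \esum_(t in D) a t.
Proof.
move=> a0 c0; rewrite /esum -ereal_supZl//; last first.
  apply/set0P; exists (\sum_(t \in set0) a t); exists set0 => //.
  exact: fsets_set0.
congr ereal_sup; rewrite image_comp.
by apply: eq_imagel => X _ /=; rewrite ge0_mule_fsumr.
Qed.

Lemma esum_dirac (x : T) : \esum_(y in [set: T]) (y == x)%:R%:E = 1 :> \bar R.
Proof.
have := @esum_set1 R T x (fun=> 1) lee01.
rewrite esum_mkcond => <-; apply: eq_esum => y _.
case: eqVneq => [->|yx]; first by rewrite mem_set.
by rewrite memNset//; exact/eqP.
Qed.

Lemma esum_sup_fset (a : T -> R) (r : R) : (forall t, 0 <= a t)%R ->
  r%:E < \esum_(t in [set: T]) (a t)%:E ->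
  exists X : {fset T}, (r < \sum_(t <- X) a t)%R.
Proof.
move=> a0 /ereal_sup_gt[_ [X [finX XD] <-]] rX.
exists (fset_set X); move: rX.
by rewrite fsbig_finite//= sumEFin lte_fin.
Qed.

Lemma le_fset_esum (a : T -> R) (X : {fset T}) : (forall t, 0 <= a t)%R ->
  (\sum_(t <- X) a t)%:E <= \esum_(t in [set: T]) (a t)%:E.
Proof.
move=> a0; apply: esum_ge; exists [set` X]; first by split.
by rewrite fsbig_finite//= set_fsetK sumEFin.
Qed.

Lemma le_term_esum (a : T -> R) (t : T) : (forall t, 0 <= a t)%R ->
  (a t)%:E <= \esum_(t in [set: T]) (a t)%:E.
Proof.
by move=> a0; have := le_fset_esum [fset t]%fset a0; rewrite big_seq_fset1.
Qed.

Lemma esum_gt0_ex (a : T -> R) : (forall t, 0 <= a t)%R ->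
  0 < \esum_(t in [set: T]) (a t)%:E -> exists t, (0 < a t)%R.
Proof.
move=> a0; apply: contraPP => /forallNP an.
rewrite esum1 ?ltxx// => t _; congr EFin; apply/eqP; rewrite eq_le a0 andbT.
by rewrite leNgt; exact/negP/an.
Qed.

End Esum.

Section Lotteries.
Context {R : realType} {Z : finType}.
Implicit Types (y w : Z -> R) (E : {set Z}).

Definition expect y w : R := \sum_z y z * w z.

Lemma expectB y y' w :
  expect (fun z => y z - y' z) w = expect y w - expect y' w.
Proof. by rewrite /expect -sumrB; apply: eq_bigr => z _; rewrite mulrBl. Qed.

Lemma expectD y y' w :
  expect (fun z => y z + y' z) w = expect y w + expect y' w.
Proof. by rewrite /expect -big_split; apply: eq_bigr => z _; rewrite mulrDl. Qed.

Lemma expectZ c y w : expect (fun z => c * y z) w = c * expect y w.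
Proof. by rewrite /expect mulr_sumr; apply: eq_bigr => z _; rewrite mulrA. Qed.

Lemma expectN y w : expect y (fun z => - w z) = - expect y w.
Proof. by rewrite /expect -sumrN; apply: eq_bigr => z _; rewrite mulrN. Qed.

Lemma expect_shift y w c : is_lottery y ->
  expect y (fun z => w z + c) = expect y w + c.
Proof.
move=> [_ y1]; rewrite /expect -[in RHS](mul1r c) -y1 mulr_suml -big_split.
by apply: eq_bigr => z _; rewrite mulrDr.
Qed.

Lemma expect_le y w c : is_lottery y -> (forall z, 0 < y z -> w z <= c) ->
  expect y w <= c.
Proof.
move=> [y0 y1] wc; rewrite -[leRHS]mul1r -y1 mulr_suml; apply: ler_sum => z _.
have := y0 z; rewrite le_eqVlt => /orP[/eqP <-|yz]; first by rewrite !mul0r.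
by rewrite ler_pM2l// wc.
Qed.

Lemma expect_ge y w c : is_lottery y -> (forall z, 0 < y z -> c <= w z) ->
  c <= expect y w.
Proof.
move=> ly wc; rewrite -lerN2 -expectN.
by apply: expect_le => // z yz; rewrite lerN2 wc.
Qed.

Lemma expect_const y w c : is_lottery y -> (forall z, 0 < y z -> w z = c) ->
  expect y w = c.
Proof.
move=> ly wc; apply/eqP; rewrite eq_le expect_le ?expect_ge//.
- by move=> z /wc ->.
- by move=> z /wc ->.
Qed.

(** A strict gap at one point of positive weight would push the expectation strictly below [c]. This
    turns optimality of a lottery into indifference over its support. *)
Lemma expect_max_const y w c :
  is_lottery y -> (forall z, 0 < y z -> w z <= c) ->
  c <= expect y w -> forall z, 0 < y z -> w z = c.
Proof.
move=> ly wc cy z yz; apply/eqP; rewrite eq_le wc// leNgt; apply/negP => wz.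
suff : expect y w < c by rewrite ltNge cy.
have [y0 y1] := ly.
rewrite -[ltRHS]mul1r -y1 mulr_suml /expect (bigD1 z)//= [ltRHS](bigD1 z)//=.
apply: ltr_leD; first by rewrite ltr_pM2l.
apply: ler_sum => z' _.
have := y0 z'; rewrite le_eqVlt => /orP[/eqP <-|yz']; first by rewrite !mul0r.
by rewrite ler_pM2l// wc.
Qed.

Lemma expect_min_const y w c :
  is_lottery y -> (forall z, 0 < y z -> c <= w z) ->
  expect y w <= c -> forall z, 0 < y z -> w z = c.
Proof.
move=> ly cw yc z yz; apply: oppr_inj.
apply: (@expect_max_const y (fun z => - w z)) => //; last by rewrite expectN lerN2.
by move=> z' yz'; rewrite lerN2 cw.
Qed.

Lemma lottery_le1 y z : is_lottery y -> y z <= 1.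
Proof.
by move=> [y0 <-]; rewrite (bigD1 z)//= lerDl; apply: sumr_ge0 => z' _.
Qed.

Lemma lottery_supp y : is_lottery y -> exists z, 0 < y z.
Proof.
move=> [y0 y1]; apply: contrapT => /forallNP yn.
suff : \sum_z y z = 0 by rewrite y1 => /eqP; rewrite oner_eq0.
apply: big1 => z _; apply/eqP; rewrite eq_le y0 andbT leNgt.
exact/negP/yn.
Qed.

Lemma lottery_mix y y' t : is_lottery y -> is_lottery y' -> 0 <= t <= 1 ->
  is_lottery (fun z => (1 - t) * y z + t * y' z).
Proof.
move=> [y0 y1] [y0' y1'] /andP[t0 t1]; split.
  by move=> z; rewrite addr_ge0 ?mulr_ge0 ?subr_ge0.
by rewrite big_split/= -!mulr_sumr y1 y1' !mulr1 subrK.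
Qed.

Lemma expect_mix y y' t w : expect (fun z => (1 - t) * y z + t * y' z) w =
  (1 - t) * expect y w + t * expect y' w.
Proof. by rewrite expectD !expectZ. Qed.

Lemma unif_gt0 E z : (0 < unif E z :> R) = (z \in E).
Proof.
rewrite /unif; case: ifP => [zE|]; last by rewrite ltxx.
by rewrite invr_gt0 ltr0n card_gt0; apply/set0Pn; exists z.
Qed.

Lemma unif_lottery E : E != finset.set0 -> is_lottery (unif E : Z -> R).
Proof.
move=> E0; split.
  by move=> z; rewrite /unif; case: ifP => // _; rewrite invr_ge0.
rewrite /unif -big_mkcond/= sumr_const -[LHS]mulr_natl mulfV//.
by rewrite pnatr_eq0 cards_eq0.
Qed.

Lemma DeltaP E y :
  Delta E y <-> is_lottery y /\ (forall z, 0 < y z -> z \in E).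
Proof.
split=> -[ly yE]; split=> // z.
  by move=> yz; apply: contraPT yz => /yE ->; rewrite ltxx.
move=> zE; apply/eqP; rewrite eq_le ly.1 andbT leNgt.
by apply: contra zE => /yE.
Qed.

Lemma DeltaS E E' y : E \subset E' -> Delta E y -> Delta E' y.
Proof.
move=> /fintype.subsetP EE' /DeltaP[ly yE]; apply/DeltaP.
by split=> // z /yE; exact: EE'.
Qed.

Lemma unif_Delta E E' : E != finset.set0 -> E \subset E' ->
  Delta E' (unif E : Z -> R).
Proof.
move=> E0 /fintype.subsetP EE'; apply/DeltaP; split; first exact: unif_lottery.
by move=> z; rewrite unif_gt0; exact: EE'.
Qed.

Lemma Delta_mix E y y' t : Delta E y -> Delta E y' -> 0 <= t <= 1 ->
  Delta E (fun z => (1 - t) * y z + t * y' z).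
Proof.
move=> [ly yE] [ly' yE'] t01; split; first exact: lottery_mix.
by move=> z zE; rewrite yE// yE'// !mulr0 addr0.
Qed.

End Lotteries.

Lemma EUE {R : realType} {n : nat} {Theta : countType} {Z : finType}
  (u : Theta -> 'I_n -> Z -> R) i th y : EU u i th y = expect y (u th i).
Proof. by []. Qed.

(** * Mixed strategies in a mechanism *)

Section MixedStrategies.
Context {R : realType} {n : nat} {Z : finType} (M : mechanism R n Z).
Local Notation profile := (forall i, msg M i).
Local Notation strategies := (forall i, msg M i -> R).
Implicit Types (m : profile) (lam : strategies).

Definition prob lam m : R := \prod_(i < n) lam i (m i).

Definition update lam i (p : msg M i -> R) : strategies :=
  @dfwith _ (fun i => msg M i -> R) lam i p.

Definition deviate m i (x : msg M i) : profile :=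
  @dfwith _ (fun i => msg M i : Type) m i x.

Definition dirac {T : eqType} (x : T) : T -> R := fun y => (y == x)%:R.

Lemma update_in lam i p : @update lam i p i = p.
Proof. exact: dfwith_in. Qed.

Lemma update_out lam i p j : j != i -> @update lam i p j = lam j.
Proof. by move=> ji; rewrite /update dfwith_out// eq_sym. Qed.

Lemma deviate_in m i x : @deviate m i x i = x.
Proof. exact: dfwith_in. Qed.

Lemma deviate_out m i x j : j != i -> @deviate m i x j = m j.
Proof. by move=> ji; rewrite /deviate dfwith_out// eq_sym. Qed.

Lemma update_mixed lam i p : is_mixed lam -> (forall x, 0 <= p x) ->
  (\esum_(x in [set: msg M i]) (p x)%:E = 1)%E -> is_mixed (@update lam i p).
Proof.
move=> lamP p0 p1 j; have [->|ji] := eqVneq j i; first by rewrite update_in.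
by rewrite update_out.
Qed.

Lemma dirac_ge0 (T : eqType) (x y : T) : 0 <= dirac x y.
Proof. by rewrite /dirac ler0n. Qed.

Lemma update_dirac_mixed lam i x :
  is_mixed lam -> is_mixed (@update lam i (dirac x)).
Proof.
move=> lamP; apply: update_mixed => //; exact: esum_dirac.
Qed.

Lemma prob_ge0 lam m : is_mixed lam -> 0 <= prob lam m.
Proof. by move=> lamP; apply: prodr_ge0 => i _; exact: (lamP i).1. Qed.

Lemma prob_gt0 lam m : is_mixed lam ->
  0 < prob lam m <-> forall i, 0 < lam i (m i).
Proof.
move=> lamP; split=> [m0 i|m0]; last by apply: prodr_gt0 => i _.
rewrite lt0r (lamP i).1 andbT; apply: contraTneq m0 => li0.
by rewrite /prob (bigD1 i)//= li0 mul0r ltxx.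
Qed.

Lemma prob_update lam i p m : prob (@update lam i p) m =
  p (m i) * \prod_(j < n | j != i) lam j (m j).
Proof.
rewrite /prob (bigD1 i)//= update_in; congr (_ * _).
by apply: eq_bigr => j ji; rewrite update_out.
Qed.

(** Profiles are grouped by what remains after overwriting the message of [i] with [x]; within a
    group the weights of [lam i] sum to 1. *)
Lemma esum_prob_deviate lam i (x : msg M i) (f : profile -> R) :
  is_mixed lam -> (forall m, 0 <= f m) ->
  (\esum_(m in [set: profile]) (prob lam m * f (deviate m x))%:E =
   \esum_(m in [set: profile]) (prob (update lam (dirac x)) m * f m)%:E)%E.
Proof.
move=> lamP f0.
pose Q m : R := \prod_(j < n | j != i) lam j (m j).
have Q0 m : 0 <= Q m by apply: prodr_ge0 => j _; exact: (lamP j).1.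
(* [I] holds one representative per group, and [e] restores the forgotten message of [i]. *)
pose I := [set m : profile | m i = x].
pose e (k : profile * msg M i) : profile := deviate k.1 k.2.
have bij_e : set_bij (I `*`` (fun=> [set: msg M i])) [set: profile] e.
  split=> //.
  - move=> [m y] [m' y'] /set_mem[/= mx _] /set_mem[/= mx' _] ee.
    have ey : y = y'.
      by rewrite -(deviate_in m y) -(deviate_in m' y') [deviate m y]ee.
    congr (_, _) => //; apply: functional_extensionality_dep => j.
    have [->|ji] := eqVneq j i; first by rewrite mx mx'.
    by rewrite -(deviate_out m y ji) -(deviate_out m' y' ji) [deviate m y]ee.
  - move=> m _; exists (deviate m x, m i) => /=.
      by split=> //=; rewrite /I/= deviate_in.
    apply: functional_extensionality_dep => j; rewrite /e/=.
    have [->|ji] := eqVneq j i; first by rewrite deviate_in.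
    by rewrite !deviate_out.
rewrite (reindex_esum _ _ _ _ bij_e).
rewrite -(@esum_esum _ _ _ I (fun=> [set: msg M i])
  (fun m y => (prob lam (deviate m y) * f (deviate (deviate m y) x))%:E)); last first.
  by move=> m y _ _; rewrite lee_fin mulr_ge0// prob_ge0.
rewrite esum_mkcond; apply: eq_esum => m _.
rewrite prob_update -/(Q m) /dirac; case: ifPn => [|mI]; last first.
  have /negbTE -> : m i != x by apply: contra mI => /eqP mx; rewrite mem_set.
  by rewrite !mul0r.
move=> /set_mem mx; rewrite (_ : m i = x)// eqxx mul1r.
rewrite (_ : (fun y => _) = (fun y => ((Q m * f m)%:E * (lam i y)%:E)%E)).
  by rewrite esumZl ?(lamP i).2 ?mule1 ?mulr_ge0// => y; rewrite lee_fin (lamP i).1.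
apply/funext => y; rewrite -EFinM; congr EFin.
have -> : deviate (deviate m y) x = m.
  apply: functional_extensionality_dep => j.
  have [->|ji] := eqVneq j i; first by rewrite deviate_in.
  by rewrite !deviate_out.
have -> : Q m = Q (deviate m y).
  by apply: eq_bigr => j ji; rewrite deviate_out.
rewrite /prob (bigD1 i)//= deviate_in -/(Q _); ring.
Qed.

Lemma mixed_supp lam : is_mixed lam -> exists m, forall i, 0 < lam i (m i).
Proof.
move=> lamP.
have h i : exists x, 0 < lam i x.
  by apply: esum_gt0_ex; [exact: (lamP i).1|rewrite (lamP i).2].
by exists (fun i => sval (cid (h i))) => i; exact: (svalP (cid (h i))).
Qed.

Lemma prob_dirac m m' : prob (fun i => dirac (m i)) m' = (m' == m)%:R.
Proof.
rewrite /prob /dirac; case: eqVneq => [->|mm'].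
  by apply: big1 => i _; rewrite eqxx.
have [i /eqP mi] : exists i, m' i <> m i.
  apply: contrapT => /forallNP h; move/eqP: mm'; apply.
  by apply: functional_extensionality_dep => i; exact: contrapT (h i).
by rewrite (bigD1 i)//= (negbTE mi) mul0r.
Qed.

(** The strategies are replaced one by one by point masses. Each replacement preserves the total
    mass, and a product of point masses has mass 1. *)
Lemma esum_prob lam : is_mixed lam ->
  (\esum_(m in [set: profile]) (prob lam m)%:E = 1)%E.
Proof.
move=> lamP; have [m _] := mixed_supp lamP.
pose lams (s : seq 'I_n) : strategies :=
  fun i => if i \in s then dirac (m i) else lam i.
have lams_mixed s : is_mixed (lams s).
  move=> i; rewrite /lams; case: ifP => _; last exact: lamP.
  by split; [exact: dirac_ge0|exact: esum_dirac].
have lamsE s : (\esum_(m in [set: profile]) (prob (lams s) m)%:E =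
                \esum_(m in [set: profile]) (prob lam m)%:E)%E.
  elim: s => [//|i s <-].
  have -> : lams (i :: s) = update (lams s) (dirac (m i)).
    apply: functional_extensionality_dep => j; rewrite {1}/lams inE.
    have [->|ji] := eqVneq j i; first by rewrite update_in.
    by rewrite update_out.
  have := @esum_prob_deviate (lams s) i (m i) (fun=> 1) (lams_mixed s).
  move=> /(_ (fun=> ler01)).
  under eq_esum do rewrite mulr1.
  by under [X in _ = X -> _]eq_esum do rewrite mulr1.
rewrite -(lamsE (enum 'I_n)).
have -> : lams (enum 'I_n) = (fun i => dirac (m i)).
  by apply: functional_extensionality_dep => i; rewrite /lams mem_enum.
rewrite -[RHS](@esum_dirac R _ (m : {classic _})).
by apply: eq_esum => m' _; rewrite prob_dirac.
Qed.

Section Expectation.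
Variable lam : strategies.
Hypothesis lamP : is_mixed lam.

(** Outcome weights are at most 1, so the sum is bounded by the total probability and [fine] loses
    nothing. *)
Let glotE z :
  ((glot lam z)%:E = \esum_(m in [set: profile]) (prob lam m * outc M m z)%:E)%E.
Proof.
rewrite /glot -/(prob lam _) fineK// fin_numElt; apply/andP; split.
  apply: lt_le_trans (ltNyr 0) _; apply: esum_ge0 => m _.
  by rewrite lee_fin mulr_ge0 ?prob_ge0//; exact: (outc_lottery M m).1.
apply: le_lt_trans (ltry 1); rewrite -(esum_prob lamP).
apply: le_esum => m _; rewrite lee_fin ler_piMr ?prob_ge0//.
exact/lottery_le1/outc_lottery.
Qed.

(** Nonnegativity of [w] allows the sums over outcomes and over profiles to be interchanged. *)
Lemma expect_glot (w : Z -> R) : (forall z, 0 <= w z) ->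
  ((expect (glot lam) w)%:E =
   \esum_(m in [set: profile]) (prob lam m * expect (outc M m) w)%:E)%E.
Proof.
move=> w0; have o0 m z : 0 <= outc M m z by exact: (outc_lottery M m).1.
rewrite /expect -sumEFin.
under eq_bigr => z _.
  rewrite mulrC EFinM glotE -esumZl//; last first.
    by move=> m; rewrite lee_fin mulr_ge0// prob_ge0.
  over.
rewrite -esum_sum; last first.
  by move=> m z _ _; rewrite mule_ge0 ?lee_fin ?mulr_ge0// prob_ge0.
apply: eq_esum => m _; rewrite mulr_sumr -sumEFin; apply: eq_bigr => z _.
by rewrite -EFinM; congr EFin; ring.
Qed.

Lemma glot_lottery : is_lottery (glot lam).
Proof.
split=> [z|].
  rewrite -lee_fin glotE; apply: esum_ge0 => m _.
  by rewrite lee_fin mulr_ge0 ?prob_ge0//; exact: (outc_lottery M m).1.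
apply: EFin_inj; have := expect_glot (fun=> ler01).
rewrite /expect; under eq_bigr do rewrite mulr1.
move=> ->; rewrite -[RHS](esum_prob lamP); apply: eq_esum => m _.
by under eq_bigr do rewrite mulr1; rewrite (outc_lottery M m).2 mulr1.
Qed.

Lemma glot_gt0 z :
  0 < glot lam z <-> exists m, 0 < prob lam m /\ 0 < outc M m z.
Proof.
have p0 m : 0 <= prob lam m * outc M m z.
  by rewrite mulr_ge0 ?prob_ge0//; exact: (outc_lottery M m).1.
rewrite -lte_fin glotE; split=> [/(esum_gt0_ex p0)[m mz]|[m [pm mz]]].
  exists m; move: mz; rewrite !lt0r mulf_eq0 negb_or -!andbA.
  by move=> /and3P[-> -> _]; rewrite prob_ge0// (outc_lottery M m).1.
apply: lt_le_trans (le_term_esum m p0).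
by rewrite lte_fin mulr_gt0.
Qed.

Lemma expect_glot_le (w : Z -> R) c :
  (forall m, 0 < prob lam m -> expect (outc M m) w <= c) ->
  expect (glot lam) w <= c.
Proof.
(* Adding [b] makes both the payoffs and the bound nonnegative, as [expect_glot] requires. *)
pose b := `|c| + \sum_z `|w z|; pose w' z := w z + b.
have w'0 z : 0 <= w' z.
  rewrite /w' /b (bigD1 z)//= addrCA addr_ge0// addrA addr_ge0//.
    by rewrite -lerBlDl sub0r -normrN ler_norm.
  exact: sumr_ge0.
have cb0 : 0 <= c + b.
  rewrite /b addrA addr_ge0//; last exact: sumr_ge0.
  by rewrite -lerBlDl sub0r -normrN ler_norm.
move=> wc; rewrite -(lerD2r b) -expect_shift; last exact: glot_lottery.
rewrite -lee_fin expect_glot// -[leRHS]mule1 -(esum_prob lamP) -esumZl//; last first.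
  by move=> m; rewrite lee_fin prob_ge0.
apply: le_esum => m _; rewrite -EFinM lee_fin (mulrC (c + b)).
have := prob_ge0 m lamP; rewrite le_eqVlt => /orP[/eqP <-|pm].
  by rewrite !mul0r.
by rewrite ler_pM2l// expect_shift; [rewrite lerD2r wc|exact: outc_lottery].
Qed.

End Expectation.

(* Fatou's lemma along the deviations [x k]: [s] is a pointwise bound on the
   payoff that the deviations attain in the limit. *)
Lemma best_response_limit lam i (x : nat -> msg M i) (w : Z -> R)
    (s : profile -> R) :
  is_mixed lam ->
  (forall k, expect (glot (update lam (dirac (x k)))) w <= expect (glot lam) w) ->
  (forall m, expect (outc M m) w <= s m) ->
  (forall m e, 0 < e -> exists N, forall k, (N <= k)%N ->
     s m - e <= expect (outc M (deviate m (x k))) w) ->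
  forall m, 0 < prob lam m -> expect (outc M m) w = s m.
Proof.
move=> lamP; pose b := \sum_z `|w z|; pose w' z := w z + b.
have w'0 z : 0 <= w' z.
  rewrite /w' /b (bigD1 z)//= addrA addr_ge0//.
    by rewrite -lerBlDl sub0r -normrN ler_norm.
  exact: sumr_ge0.
pose f m := expect (outc M m) w'.
have fE m : f m = expect (outc M m) w + b.
  by rewrite /f expect_shift//; exact: outc_lottery.
have f0 m : 0 <= f m by apply: expect_ge => //; exact: outc_lottery.
move=> devle vles devlim m0 pm0; apply/eqP; rewrite eq_le vles/= leNgt.
apply/negP => ltm0.
(* [d] is the weighted shortfall at [m0]; the errors below are kept to two thirds of it. *)
pose d := prob lam m0 * (s m0 - expect (outc M m0) w).
have d0 : 0 < d by rewrite mulr_gt0// subr_gt0.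
have Ef := expect_glot lamP w'0; set E := expect _ _ in Ef.
have pf0 m : 0 <= prob lam m * f m by rewrite mulr_ge0// prob_ge0.
have [X ltX] : exists X : {fset profile},
    E - d / 3 < \sum_(m <- X) prob lam m * f m.
  apply: esum_sup_fset => //.
  by rewrite -[ltRHS]Ef lte_fin ltrBlDr ltrDl divr_gt0.
pose Y := (m0 |` X)%fset.
have YX : \sum_(m <- X) prob lam m * f m <= \sum_(m <- Y) prob lam m * f m.
  have [m0X|m0X] := boolP (m0 \in X).
    by rewrite /Y mem_fset1U.
  by rewrite /Y big_fsetU1//= lerDr.
(* Finiteness of [Y] lets one [N] serve all of its profiles. *)
have [N NP] : exists N, forall m, m \in Y -> forall k, (N <= k)%N ->
    s m - d / 3 <= expect (outc M (deviate m (x k))) w.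
  have d30 : 0 < d / 3 by rewrite divr_gt0.
  pose g m := sval (cid (devlim m _ d30)).
  exists (\max_(m <- Y) g m) => m mY k.
  rewrite (big_rem m)//= geq_max => /andP[gk _].
  exact: (svalP (cid (devlim m _ d30))).
have := devle N; rewrite leNgt => /negP; apply.
have lamNP := update_dirac_mixed (x N) lamP.
rewrite -(ltrD2r b) -!expect_shift; [|exact: glot_lottery..].
rewrite -/w' -/E -lte_fin (expect_glot lamNP w'0).
have -> := esym (esum_prob_deviate (x N) lamP f0).
apply: lt_le_trans (le_fset_esum Y _); last first.
  by move=> m; rewrite mulr_ge0// prob_ge0.
have Y1 : \sum_(m <- Y) prob lam m <= 1.
  rewrite -lee_fin -(esum_prob lamP); apply: le_fset_esum => m.
  exact: prob_ge0.
have Yd : d <= \sum_(m <- Y) prob lam m * (s m - expect (outc M m) w).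
  rewrite (big_fsetD1 m0) ?fset1U1//= lerDl; apply: sumr_ge0 => m _.
  by rewrite mulr_ge0 ?prob_ge0// subr_ge0.
(* On [Y] the deviation gains at least [d] less [d / 3]; profiles outside [Y] account for less than
   [d / 3] of [E]. Hence the deviation would gain more than [d / 3]. *)
have le3 : \sum_(m <- Y) prob lam m * f m +
    \sum_(m <- Y) prob lam m * (s m - expect (outc M m) w) -
    d / 3 * \sum_(m <- Y) prob lam m <=
    \sum_(m <- Y) prob lam m * f (deviate m (x N)).
  rewrite mulr_sumr -big_split/= -sumrB big_seq [leRHS]big_seq.
  apply: ler_sum => m mY; rewrite (mulrC (d / 3)) -mulrDr -mulrBr.
  rewrite ler_wpM2l ?prob_ge0// !fE.
  by have := NP m mY N (leqnn N); lra.
rewrite lte_fin; apply: lt_le_trans le3.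
have : d / 3 * \sum_(m <- Y) prob lam m <= d / 3.
  by rewrite ler_piMr// divr_ge0// ltW.
move: ltX YX Yd; lra.
Qed.

End MixedStrategies.

(** * Maximal sets and reduced lower sets *)

Lemma argmaxP {R : realType} {Z : finType} (f : Z -> R) (E : {set Z}) z :
  reflect (z \in E /\ forall z', z' \in E -> f z' <= f z) (z \in argmax_in f E).
Proof. by rewrite !inE; apply: (iffP andP) => -[zE /forall_inP]. Qed.

Lemma argminP {R : realType} {Z : finType} (f : Z -> R) (E : {set Z}) z :
  reflect (z \in E /\ forall z', z' \in E -> f z <= f z') (z \in argmin_in f E).
Proof. by rewrite !inE; apply: (iffP andP) => -[zE /forall_inP]. Qed.

Section SCC.
Context {R : realType} {n : nat} {Theta : countType} {Z : finType}.
Variables (u : Theta -> 'I_n -> Z -> R) (F : Theta -> {set Z}).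
Implicit Types (i j : 'I_n) (th : Theta) (E W : {set Z}) (y : Z -> R).

Lemma imax_thP W i th E : reflect
  [/\ E != finset.set0, E \subset W,
      forall z z', z \in E -> z' \in E -> u th i z = u th i z' &
      forall j, j != i -> forall z z',
        z \in E -> z' \in W -> u th j z' <= u th j z]
  (imax_th u W i th E).
Proof.
apply: (iffP and4P) => -[E0 EW Ei Ej]; split=> //.
- move=> z z' zE z'E; move/fintype.subsetP: Ei => Ei.
  have /argmaxP[_ zmax] := Ei _ zE; have /argmaxP[_ z'max] := Ei _ z'E.
  by apply/eqP; rewrite eq_le zmax// z'max.
- move=> j ji z z' zE z'W; move/forallP: Ej => /(_ j); rewrite ji/=.
  by move=> /fintype.subsetP/(_ _ zE)/argmaxP[_]; exact.
- apply/fintype.subsetP => z zE; apply/argmaxP; split=> // z' z'E.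
  by rewrite (Ei z z').
- apply/forallP => j; apply/implyP => ji; apply/fintype.subsetP => z zE.
  apply/argmaxP; split; first exact: (fintype.subsetP EW).
  by move=> z' z'W; exact: Ej.
Qed.

Lemma imax_thS W i th E E' : E' != finset.set0 -> E' \subset E ->
  imax_th u W i th E -> imax_th u W i th E'.
Proof.
move=> E'0 E'E /imax_thP[_ EW Ei Ej]; apply/imax_thP; split=> //.
- exact: fintype.subset_trans EW.
- by move=> z z' /(fintype.subsetP E'E) zE /(fintype.subsetP E'E); exact: Ei.
- by move=> j ji z z' /(fintype.subsetP E'E); exact: Ej.
Qed.

Lemma F_sub_Zstar th : F th \subset Zstar u F.
Proof.
apply/fintype.subsetP => z zF; rewrite /Zstar; case: ifP => _; rewrite !inE//.
by apply/asboolP; exists th.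
Qed.

Lemma bigcapFP (K : set Theta) z :
  reflect (forall th, K th -> z \in F th) (z \in bigcapF F K).
Proof. by rewrite inE; exact: asboolP. Qed.

Definition lowerZstar i th : {set Z} := Zstar u F :&: lowerZset u i th (F th).

Lemma lowerZstarP i th z : reflect
  (z \in Zstar u F /\ forall z', z' \in F th -> u th i z <= u th i z')
  (z \in lowerZstar i th).
Proof. by rewrite !inE; apply: (iffP andP) => -[? /forall_inP]. Qed.

(** The test that selects the first branch of [hatL]; [reducedZ] is the support which that branch
    allows. *)
Definition reduced i th : Prop :=
  F th \subset argmin_in (u th i) (Zstar u F) /\ Xi u F i th !=set0 /\
  iZstar_max u F i (lowerZstar i th).

Definition reducedZ i th : {set Z} := (lowerZstar i th :&:
  [set z | `[< exists K, Xi u F i th K /\ z \in bigcapF F K >]])%SET.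

Lemma reducedZP i th z : reflect
  (z \in lowerZstar i th /\ exists K, Xi u F i th K /\ z \in bigcapF F K)
  (z \in reducedZ i th).
Proof.
apply: (iffP finset.setIP) => -[zD zK]; split=> //.
  by move: zK; rewrite inE => /asboolP.
by rewrite inE; exact/asboolP.
Qed.

Lemma hatLE i th : hatL u F i th = if `[< reduced i th >]
  then Delta (reducedZ i th)
  else Delta (Zstar u F) `&` lowerY u i th (unif (F th)).
Proof. by []. Qed.

Lemma F_sub_lowerZstar i th :
  F th \subset argmin_in (u th i) (Zstar u F) -> F th \subset lowerZstar i th.
Proof.
move=> /fintype.subsetP Fmin; apply/fintype.subsetP => z zF.
have /argminP[zZ zmin] := Fmin _ zF; apply/lowerZstarP; split=> // z' z'F.
exact/zmin/(fintype.subsetP (F_sub_Zstar th)).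
Qed.

(* [K] is a fixed point of the monotone iteration
   [E |-> lowerZstar i th :&: bigcapF (ThetaI i th `&` Lambda i E)]
   started from [E = lowerZstar i th]; every iterate contains [C]. *)
Lemma Xi_above i th (C : {set Z}) :
  F th != finset.set0 -> F th \subset lowerZstar i th ->
  C != finset.set0 -> C \subset lowerZstar i th ->
  ThetaI u F i th `&` Lambda u F i (lowerZstar i th) !=set0 ->
  (forall th', ThetaI u F i th th' -> Lambda u F i C th' -> C \subset F th') ->
  exists K, Xi u F i th K /\ C \subset bigcapF F K.
Proof.
move=> F0 FD C0 CD Kne CF.
pose K E := ThetaI u F i th `&` Lambda u F i E.
pose phi E := lowerZstar i th :&: bigcapF F (K E).
(* A larger set is a max set in fewer states, so fewer sets are intersected. *)
have phiS E E' : E != finset.set0 -> E \subset E' -> phi E \subset phi E'.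
  move=> E0 EE'; apply: finset.setIS; apply/fintype.subsetP => z /bigcapFP zE.
  by apply/bigcapFP => th' [th'T th'L]; apply: zE; split=> //; exact: imax_thS th'L.
suff : forall E, C \subset E -> K E !=set0 -> phi E \subset E ->
    exists K, Xi u F i th K /\ C \subset bigcapF F K.
  by move/(_ (lowerZstar i th)); apply=> //; exact: finset.subsetIl.
move=> E; move: {2}#|E|.+1 (ltnSn #|E|) => k; elim: k E => // k IHk E.
rewrite ltnS => Ek CE KE phiE.
have Cphi : C \subset phi E.
  rewrite finset.subsetI CD/=; apply/fintype.subsetP => z zC.
  apply/bigcapFP => th' [th'T th'L]; apply: (fintype.subsetP (CF th' th'T _)) => //.
  exact: imax_thS th'L.
have phi0 : phi E != finset.set0.
  by apply: contraNneq C0 => phi0; rewrite -finset.subset0 -phi0.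
(* At a fixed point [K E] solves the equation defining [Xi]; otherwise [phi E] is strictly smaller
   and the induction on cardinality continues. *)
have [eqE|neqE] := eqVneq (phi E) E.
  exists (K E); split; last by apply: fintype.subset_trans Cphi (finset.subsetIr _ _).
  by split; [exact: subIsetl|split=> //; rewrite -/(lowerZstar i th) -/(phi E) eqE].
apply: (IHk (phi E)) => //.
- apply: leq_trans Ek; apply: proper_card.
  by rewrite finset.properEneq neqE.
- case: KE => th' [th'T th'L]; exists th'; split=> //; exact: imax_thS th'L.
- exact: phiS.
Qed.

(* Deviations from [b] are moved to deviations from [unif (F th)], which has
   full support on [F th]: [unif (F th) + (y - b) / #|F th|] is a lottery. *)
Lemma hatL_transfer i th th' b y : F th != finset.set0 ->
  hatL u F i th `<=` lowerY u i th' (unif (F th)) ->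
  Delta (F th) b -> Delta (Zstar u F) y -> EU u i th y <= EU u i th b ->
  (reduced i th -> F th \subset reducedZ i th /\ Delta (reducedZ i th) y) ->
  EU u i th' y <= EU u i th' b.
Proof.
move=> F0 hatS bF yZ yb yred.
pose e : R := (#|F th|%:R)^-1.
have e0 : 0 < e by rewrite invr_gt0 ltr0n card_gt0.
pose x z := unif (F th) z + e * (y z - b z).
have [lb bFz] := bF; have [ly yZz] := yZ; have lun := @unif_lottery R Z _ F0.
(* Weights stay nonnegative: on [F th] the uniform weight is [e] while [b] is at most 1, and [b]
   vanishes elsewhere. *)
have lx : is_lottery x.
  split=> [z|].
    rewrite /x mulrBr addrCA addr_ge0 ?mulr_ge0 ?(ltW e0)//; first exact: ly.1.
    rewrite subr_ge0 /unif; case: ifPn => [zF|/bFz ->]; last by rewrite mulr0.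
    by rewrite -/e -[leRHS]mulr1 ler_pM2l// lottery_le1.
  rewrite /x big_split/= lun.2 -mulr_sumr sumrB ly.2 lb.2; ring.
have xE E : F th \subset E -> Delta E y -> Delta E x.
  move=> FE yE; split=> // z zE.
  rewrite /x yE.2// (DeltaS FE bF).2// (@unif_Delta R Z _ _ F0 FE).2//; ring.
(* In every state, [x] compares with [unif (F th)] exactly as [y] compares with [b]. *)
have EUx th0 : EU u i th0 x = EU u i th0 (unif (F th)) +
    e * (EU u i th0 y - EU u i th0 b).
  by rewrite !EUE /x expectD expectZ expectB.
have : hatL u F i th x.
  rewrite hatLE; case: asboolP => [/yred[FS yS]|_]; first exact: xE.
  split; first by apply: xE => //; exact: F_sub_Zstar.
  by split=> //; rewrite EUx gerDl pmulr_rle0// subr_le0.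
by move=> /hatS[_]; rewrite EUx gerDl pmulr_rle0// subr_le0.
Qed.
End SCC.

(** * Necessity *)

Section Necessity.
Context {R : realType} {n : nat} {Theta : countType} {Z : finType}.
Variables (u : Theta -> 'I_n -> Z -> R) (F : Theta -> {set Z}).
Variable M : mechanism R n Z.
Hypothesis F_neq0 : forall th, F th != finset.set0.
Hypothesis implM : forall th z,
  z \in F th <-> exists lam, MNE u M th lam /\ supp (glot lam) z.
Local Notation profile := (forall i, msg M i).
Local Notation strategies := (forall i, msg M i -> R).
Implicit Types (lam : strategies) (m : profile).

(** The message of [i] is left free: only the strategies of the others in [lam] matter. *)
Definition attainable lam i : {set Z} :=
  [set z | `[< exists m,
    (forall j, j != i -> 0 < lam j (m j)) /\ 0 < outc M m z >]]%SET.

Lemma attainableP lam i z : reflect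
  (exists m, (forall j, j != i -> 0 < lam j (m j)) /\ 0 < outc M m z)
  (z \in attainable lam i).
Proof. by rewrite inE; exact: asboolP. Qed.

Lemma glot_attainable lam lam' i z : is_mixed lam' ->
  (forall j, j != i -> lam' j = lam j) ->
  0 < glot lam' z -> z \in attainable lam i.
Proof.
move=> lamP' lamE /glot_gt0-/(_ lamP')[m [/prob_gt0-/(_ lamP') pm mz]].
by apply/attainableP; exists m; split=> // j ji; rewrite -lamE.
Qed.

Lemma attainable_glot lam i z : is_mixed lam -> z \in attainable lam i ->
  exists x : msg M i, 0 < glot (update lam (dirac x)) z.
Proof.
move=> lamP /attainableP[m [pm mz]]; exists (m i).
have lamP' := update_dirac_mixed (m i) lamP.
apply/glot_gt0 => //; exists m; split=> //; apply/prob_gt0 => // j.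
have [->|ji] := eqVneq j i; last by rewrite update_out// pm.
by rewrite update_in /dirac eqxx ltr01.
Qed.

(** If all of [Z] is a max set at [th], every agent is indifferent over [Z] there, so every profile
    is an equilibrium at [th]. *)
Lemma outc_sub_Zstar m z : 0 < outc M m z -> z \in Zstar u F.
Proof.
rewrite /Zstar; case: ifPn => [/asboolP[i [th /imax_thP[_ _ ui uj]]] mz|_ _];
  last by rewrite inE.
rewrite inE; apply/asboolP; exists th; apply/implM.
pose lam : strategies := fun i => dirac (m i).
have lamP : is_mixed lam.
  by move=> j; split; [exact: dirac_ge0|exact: esum_dirac].
have uconst j z1 : u th j z1 = u th j z.
  have [->|ji] := eqVneq j i; first by rewrite (ui z1 z) ?inE.
  by apply/eqP; rewrite eq_le !(uj j ji) ?inE.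
exists lam; split; last first.
  by apply/glot_gt0 => //; exists m; split=> //; rewrite prob_dirac eqxx ltr01.
split=> // j lam' lamP' _; rewrite !EUE.
have cst lam0 : is_mixed lam0 -> expect (glot lam0) (u th j) = u th j z.
  by move=> lamP0; apply: expect_const => //; exact: glot_lottery.
by rewrite !cst.
Qed.

Lemma glot_Zstar lam : is_mixed lam -> Delta (Zstar u F) (glot lam).
Proof.
move=> lamP; apply/DeltaP; split; first exact: glot_lottery.
by move=> z /glot_gt0-/(_ lamP)[m [_]]; exact: outc_sub_Zstar.
Qed.

Lemma attainable_Zstar lam i z : z \in attainable lam i -> z \in Zstar u F.
Proof. by move=> /attainableP[m [_]]; exact: outc_sub_Zstar. Qed.

Lemma MNE_glot th lam : MNE u M th lam -> Delta (F th) (glot lam).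
Proof.
move=> lamN; apply/DeltaP; split; first by apply: glot_lottery; case: lamN.
by move=> z zlam; apply/implM; exists lam.
Qed.

(* Every unilateral deviation of [i] from [lam] is then an equilibrium at [th]. *)
Lemma attainable_imax lam i th : is_mixed lam ->
  imax_th u (Zstar u F) i th (attainable lam i) ->
  attainable lam i \subset F th.
Proof.
move=> lamP /imax_thP[_ AZ Ai Aj]; apply/fintype.subsetP => z zA.
have [x zx] := attainable_glot lamP zA; apply/implM.
set lamx := update lam (dirac x) in zx.
have lamxP : is_mixed lamx := update_dirac_mixed x lamP.
have lamxE j : j != i -> lamx j = lam j by move=> ji; rewrite /lamx update_out.
exists lamx; split=> //; split=> // j lam' lamP' lamE; rewrite !EUE.
have [ji|ji] := eqVneq j i; last first.
  apply: (@le_trans _ _ (u th j z)).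
    apply: expect_le; first exact: glot_lottery.
    move=> z' z'lam; apply: Aj => //.
    by have /DeltaP[_] := glot_Zstar lamP'; exact.
  apply: expect_ge; first exact: glot_lottery.
  move=> z' z'lam; apply: Aj => //; last exact: (fintype.subsetP AZ).
  exact: glot_attainable lamxE z'lam.
have lamE' k : k != i -> lam' k = lam k.
  by move=> ki; rewrite lamE ?ji// lamxE.
rewrite ji (@expect_const _ _ _ _ (u th i z)) ?(@expect_const _ _ (glot lamx) _
  (u th i z))//.
- exact: glot_lottery.
- by move=> z' z'lam; apply: Ai => //; exact: glot_attainable lamxE z'lam.
- exact: glot_lottery.
- by move=> z' z'lam; apply: Ai => //; exact: glot_attainable lamE' z'lam.
Qed.

(** The equilibrium gives [i] her minimum over [Zstar]. A deviation cannot pay more, and no outcome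
    pays less, so every attainable outcome pays exactly this minimum. *)
Lemma attainable_lowerZstar lam i th : MNE u M th lam ->
  F th \subset argmin_in (u th i) (Zstar u F) ->
  attainable lam i \subset lowerZstar u F i th.
Proof.
move=> lamN /fintype.subsetP Fmin; have [lamP lamBR] := lamN.
apply/fintype.subsetP => z zA; have zZ := attainable_Zstar zA.
apply/lowerZstarP; split=> // z' z'F.
have /argminP[_ z'min] := Fmin _ z'F.
have [x zx] := attainable_glot lamP zA.
set lamx := update lam (dirac x) in zx.
have lamxP : is_mixed lamx := update_dirac_mixed x lamP.
have /DeltaP[_ lamF] := MNE_glot lamN.
have : EU u i th (glot lamx) <= u th i z'.
  apply: (@le_trans _ _ (EU u i th (glot lam))).
    by apply: lamBR => // j ji; rewrite /lamx update_out.
  apply: expect_le; first exact: glot_lottery.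
  move=> t /lamF tF; have /argminP[_ tmin] := Fmin _ tF.
  exact/tmin/(fintype.subsetP (F_sub_Zstar u F th)).
move=> le; rewrite (expect_min_const (glot_lottery lamxP) _ le zx)// => t tx.
by apply: z'min; have /DeltaP[_] := glot_Zstar lamxP; exact.
Qed.

Lemma attainable_reducedZ lam i th : MNE u M th lam -> reduced u F i th ->
  attainable lam i \subset reducedZ u F i th.
Proof.
move=> lamN [Fmin [_ [th1 th1D]]]; have [lamP _] := lamN.
have FD := F_sub_lowerZstar Fmin.
have A0 lam0 : is_mixed lam0 -> attainable lam0 i != finset.set0.
  move=> lamP0; have [z zlam] := lottery_supp (glot_lottery lamP0).
  by apply/finset.set0Pn; exists z; apply: glot_attainable zlam.
have AD := attainable_lowerZstar lamN Fmin.
have [||K [KXi KA]] := @Xi_above _ _ _ _ u F i th (attainable lam i)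
    (F_neq0 th) FD (A0 _ lamP) AD.
(* For [F th \subset F th1]: each [z] in [F th] is attainable in some equilibrium at [th], whose
   attainable set lies in [lowerZstar], hence is a max set at [th1] and is contained in [F th1]. *)
- exists th1; split=> //; split; first exact: imax_thS th1D.
  apply/fintype.subsetP => z /implM[lam1 [lam1N zlam1]].
  have lamP1 := lam1N.1; have AD1 := attainable_lowerZstar lam1N Fmin.
  apply: (fintype.subsetP (attainable_imax lamP1 (imax_thS (A0 _ lamP1) AD1 th1D))).
  exact: glot_attainable zlam1.
- by move=> th' _ ?; exact: attainable_imax.
apply/fintype.subsetP => z zA; apply/reducedZP; split.
  exact: (fintype.subsetP AD).
by exists K; split=> //; exact: (fintype.subsetP KA).
Qed.

Lemma implementable_monotone : hat_uniform_monotonicity u F.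
Proof.
move=> th th' hatS; apply/fintype.subsetP => z /implM[lam [lamN zlam]].
apply/implM; exists lam; split=> //; have [lamP lamBR] := lamN.
split=> // i lam' lamP' lamE.
apply: (hatL_transfer (F_neq0 th) (hatS i) (MNE_glot lamN)).
- exact: glot_Zstar.
- exact: lamBR.
- move=> red; split; last first.
    apply/DeltaP; split; first exact: glot_lottery.
    move=> t tlam; apply: (fintype.subsetP (attainable_reducedZ lamN red)).
    exact: glot_attainable tlam.
  (* Each outcome of [F th] is attainable in its own equilibrium [lam1], which may differ from
     [lam]. *)
  apply/fintype.subsetP => t /implM[lam1 [lam1N tlam1]].
  apply: (fintype.subsetP (attainable_reducedZ lam1N red)).
  by apply: glot_attainable tlam1; case: lam1N.
Qed.
End Necessity.

(** * Sufficiency *)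

(** Serves to move a lottery with slack [a] in a lower set towards another one without leaving the
    set; [b] may have either sign. *)
Lemma small_step {R : realFieldType} (a b : R) :
  0 < a -> exists t, [/\ 0 < t, t <= 1 & t * b < a].
Proof.
move=> a0; have ab0 : 0 < a + `|b| by rewrite ltr_pwDl.
exists (a / (a + `|b|)); split; first exact: divr_gt0.
  by rewrite ler_pdivrMr// mul1r lerDl.
rewrite mulrAC ltr_pdivrMr// ltr_pM2l//.
by apply: le_lt_trans (ler_norm b) _; rewrite ltrDr.
Qed.

Lemma expect_unif1 {R : realType} {Z : finType} (z : Z) (w : Z -> R) :
  expect (unif [set z]%SET) w = w z.
Proof.
apply: expect_const.
  by apply: unif_lottery; apply/finset.set0Pn; exists z; rewrite inE.
by move=> z'; rewrite unif_gt0 inE => /eqP ->.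
Qed.

Lemma unif1_Delta {R : realType} {Z : finType} (E : {set Z}) z : z \in E ->
  Delta E (unif [set z]%SET : Z -> R).
Proof.
move=> zE; apply: unif_Delta; last by rewrite finset.sub1set.
by apply/finset.set0Pn; exists z; rewrite inE.
Qed.

(** Degenerate lotteries compete with [y], so no point of [E] pays more than the expectation, and
    the support of [y] pays exactly that. *)
Lemma Delta_max_const {R : realType} {Z : finType} (E : {set Z})
    (y w : Z -> R) : Delta E y ->
  (forall y', Delta E y' -> expect y' w <= expect y w) ->
  forall z z', 0 < y z -> z' \in E -> w z' <= w z.
Proof.
move=> /DeltaP[ly yE] ymax z z' yz z'E.
have wle z0 : z0 \in E -> w z0 <= expect y w.
  by move=> z0E; rewrite -(expect_unif1 z0 w); exact/ymax/unif1_Delta.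
have -> : w z = expect y w.
  by apply: (expect_max_const ly) => // z0 /yE /wle.
exact: wle.
Qed.

Lemma PNE_MNE {R : realType} {n : nat} {Theta : countType} {Z : finType}
    (u : Theta -> 'I_n -> Z -> R) (M : mechanism R n Z) th m :
  PNE u M th m -> exists lam, MNE u M th lam /\
    forall z, 0 < outc M m z -> supp (glot lam) z.
Proof.
move=> mN; pose lam i : msg M i -> R := dirac (m i).
have lamP : is_mixed lam.
  by move=> i; split; [exact: dirac_ge0|exact: esum_dirac].
have probE m' : prob lam m' = (m' == m :> {classic (forall i, msg M i)})%:R.
  exact: prob_dirac.
have supp_lam z : 0 < outc M m z -> supp (glot lam) z.
  by move=> mz; apply/glot_gt0 => //; exists m; rewrite probE eqxx ltr01.
exists lam; split=> //; split=> // i lam' lamP' lamE; rewrite !EUE.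
apply: (@le_trans _ _ (expect (outc M m) (u th i))).
  apply: expect_glot_le => // m' /prob_gt0-/(_ lamP') m'0.
  apply: mN => j ji; move: (m'0 j); rewrite lamE// /lam /dirac.
  by case: eqVneq => // _; rewrite ltxx.
rewrite -lerN2.
rewrite -!expectN; apply: expect_glot_le => // m'; rewrite probE.
by case: eqVneq => [->//|_]; rewrite ltxx.
Qed.

(** * Reduced lower sets under monotonicity, and lotteries of large support in them *)

Section HatL.
Context {R : realType} {n : nat} {Theta : countType} {Z : finType}.
Variables (u : Theta -> 'I_n -> Z -> R) (F : Theta -> {set Z}).
Hypothesis F_neq0 : forall th, F th != finset.set0.
Implicit Types (i j : 'I_n) (th : Theta) (E : {set Z}) (y : Z -> R).
Local Notation Zs := (Zstar u F).
Local Notation hatL := (hatL u F).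

Lemma reducedZ_sub_Zstar i th : reducedZ u F i th \subset Zs.
Proof.
by apply/fintype.subsetP => z /reducedZP[/lowerZstarP[]].
Qed.

(** Any [K] in [Xi] consists of states of [ThetaI], whose values of [F] contain [F th]. *)
Lemma F_sub_reducedZ i th : reduced u F i th -> F th \subset reducedZ u F i th.
Proof.
move=> [Fmin [[K KXi] _]]; apply/fintype.subsetP => z zF; apply/reducedZP.
split; first exact: (fintype.subsetP (F_sub_lowerZstar Fmin)).
exists K; split=> //; apply/bigcapFP => th' /KXi.1[_ /fintype.subsetP]; exact.
Qed.

Lemma hatL_Zstar i th y : hatL i th y -> Delta Zs y.
Proof.
rewrite hatLE; case: asboolP => [_|_ []//].
by apply: DeltaS; exact: reducedZ_sub_Zstar.
Qed.

Lemma hatL_unif i th : hatL i th (unif (F th)).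
Proof.
rewrite hatLE; case: asboolP => [red|_].
  by apply: unif_Delta => //; exact: F_sub_reducedZ.
split; first by apply: unif_Delta => //; exact: F_sub_Zstar.
by split=> //; exact: unif_lottery.
Qed.

Lemma lowerZstar_lowerY i th y : Delta (lowerZstar u F i th) y ->
  lowerY u i th (unif (F th)) y.
Proof.
move=> /DeltaP[ly yD]; split=> //; apply: expect_le => // z /yD.
move=> /lowerZstarP[_ zle]; apply: expect_ge; first exact: unif_lottery.
by move=> z'; rewrite unif_gt0; exact: zle.
Qed.

Lemma hatL_lowerY i th : hatL i th `<=` lowerY u i th (unif (F th)).
Proof.
move=> y; rewrite hatLE; case: asboolP => [_ yS|_ []//].
apply: lowerZstar_lowerY; apply: DeltaS yS.
exact: finset.subsetIl.
Qed.

Lemma hatL_mix i th y y' t : hatL i th y -> hatL i th y' -> 0 <= t <= 1 ->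
  hatL i th (fun z => (1 - t) * y z + t * y' z).
Proof.
rewrite hatLE; case: asboolP => [_|_]; first exact: Delta_mix.
move=> [yZ [ly yle]] [y'Z [ly' y'le]] t01; split; first exact: Delta_mix.
split; first exact: lottery_mix.
case/andP: t01 => t0 t1.
rewrite EUE expect_mix; set c := EU _ _ _ (unif _) in yle y'le *.
have -> : c = (1 - t) * c + t * c by ring.
by apply: lerD; rewrite ler_wpM2l// subr_ge0.
Qed.

(** Here [unif (F th)] pays the minimum over [Zs], so a lottery paying no more is supported on
    minimizers. *)
Lemma Delta_lowerZstar i th : F th \subset argmin_in (u th i) Zs ->
  Delta Zs `&` lowerY u i th (unif (F th)) = Delta (lowerZstar u F i th).
Proof.
move=> /fintype.subsetP Fmin; apply/seteqP; split=> y.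
  move=> [/DeltaP[ly yZ] [_ yle]]; apply/DeltaP; split=> // z yz.
  apply/lowerZstarP; split; first exact: yZ.
  move=> z' z'F; have /argminP[z'Z z'min] := Fmin _ z'F.
  have EUF : EU u i th (unif (F th)) = u th i z'.
    apply: expect_const; first exact: unif_lottery.
    move=> t; rewrite unif_gt0 => tF; have /argminP[tZ tmin] := Fmin _ tF.
    by apply/eqP; rewrite eq_le tmin// z'min.
  rewrite EUF in yle.
  by rewrite (expect_min_const ly _ yle yz)// => t /yZ; exact: z'min.
move=> yD; split; last exact: lowerZstar_lowerY.
by apply: DeltaS yD; exact: finset.subsetIl.
Qed.

Section Monotone.
Hypothesis mono : hat_uniform_monotonicity u F.
Hypothesis n_gt0 : (0 < n)%N.

(** Indifference makes the premise of monotonicity hold from every [th'], so [F th] contains all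
    values of [F]. Their union is [Zs] when [Z] is a max set; otherwise [Zs] is [Z], and the
    indifference would make [Z] a max set. *)
Lemma Zstar_indifferent th : (forall i z z', z \in Zs -> z' \in Zs ->
  u th i z <= u th i z') -> Zs \subset F th.
Proof.
move=> ind; have Fth th' : F th' \subset F th.
  apply: mono => i y /hatL_Zstar/DeltaP[ly yZ]; split=> //.
  apply: expect_le => // z /yZ zZ; apply: expect_ge; first exact: unif_lottery.
  move=> z'; rewrite unif_gt0 => z'F; apply: ind => //.
  exact: (fintype.subsetP (F_sub_Zstar u F th')).
apply/fintype.subsetP => z; move: ind; rewrite /Zstar.
case: asboolP => [_ _|nimax ind].
  by rewrite inE => /asboolP[th']; exact: (fintype.subsetP (Fth th')).
exfalso; apply: nimax; exists (Ordinal n_gt0), th; apply/imax_thP; split=> //.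
- by apply/finset.set0Pn; exists z; rewrite inE.
- by move=> z1 z2 z1T z2T; apply/eqP; rewrite eq_le !ind.
- by move=> j _ z1 z2 z1T z2T; exact: ind.
Qed.

Lemma Delta_unif_imax i th E : E != finset.set0 -> E \subset Zs ->
  (forall j, j != i -> forall z z', 0 < (unif E : Z -> R) z -> z' \in Zs ->
     u th j z' <= u th j z) ->
  (forall y, Delta E y -> EU u i th y <= EU u i th (unif E)) ->
  imax_th u Zs i th E.
Proof.
move=> E0 EZ jmax imax; apply/imax_thP; split=> //; last first.
  by move=> j ji z z' zE; apply: jmax => //; rewrite unif_gt0.
have EE : Delta E (unif E : Z -> R) by exact: unif_Delta.
move=> z z' zE z'E; apply/eqP; rewrite eq_le.
by rewrite !(Delta_max_const EE imax)// unif_gt0.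
Qed.

(** At [th'] the other agents find [F th] optimal in [Zs], and [i] is indifferent over [E], to which
    her choices are confined; monotonicity then applies. *)
Lemma imax_hatL_sub i th th' E : imax_th u Zs i th' E -> F th \subset E ->
  hatL i th `<=` Delta E -> F th \subset F th'.
Proof.
move=> /imax_thP[_ EZ Ei Ej] FE LE; apply: mono => j y Ly.
have /DeltaP[ly yZ] := hatL_Zstar Ly; split=> //.
apply: expect_le => // z yz; apply: expect_ge; first exact: unif_lottery.
move=> z'; rewrite unif_gt0 => /(fintype.subsetP FE) z'E.
have [ji|ji] := eqVneq j i; last by apply: Ej => //; exact: yZ.
move: Ly; rewrite ji => /LE/DeltaP[_ yE].
by rewrite (Ei z z')// yE.
Qed.

(* [full_point L i y0]: [y0] has enough support in [L] to be mixed into every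
   outcome chosen by [i] from [L] and exclude undesired equilibria. *)
Definition full_point (L : set (Z -> R)) i y0 : Prop :=
  L y0 /\ forall th,
    (forall j, j != i -> forall z z', 0 < y0 z -> z' \in Zs ->
       u th j z' <= u th j z) ->
    (forall y, L y -> EU u i th y <= EU u i th y0) ->
    forall y, L y -> forall z, 0 < y z -> z \in F th.

Lemma full_point_Zstar i :
  Zs != finset.set0 -> full_point (Delta Zs) i (unif Zs).
Proof.
move=> Z0; split; first exact: unif_Delta.
move=> th jmax imax y /DeltaP[_ yZ] z /yZ; apply/fintype.subsetP.
apply: Zstar_indifferent => j z1 z2 z1Z z2Z.
have /imax_thP[_ _ ui uj] := Delta_unif_imax Z0 (fintype.subxx _) jmax imax.
have [->|ji] := eqVneq j i; first by rewrite (ui z1 z2).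
exact: uj.
Qed.

(** Optimality makes [reducedZ] a max set at [th'], and monotonicity puts [th'] in [ThetaI]. If [K]
    in [Xi] witnesses [z], the set in the fixed-point equation of [K] is part of [reducedZ], hence a
    max set too; so [th'] is in [K] and [z] in [F th']. *)
Lemma full_point_reduced i th : reduced u F i th ->
  full_point (hatL i th) i (unif (reducedZ u F i th)).
Proof.
move=> red; have FS := F_sub_reducedZ red.
have [Fmin [_ _]] := red; have FD := F_sub_lowerZstar Fmin.
have -> : hatL i th = Delta (reducedZ u F i th) by rewrite hatLE asboolT.
have S0 : reducedZ u F i th != finset.set0.
  by apply: contraNneq (F_neq0 th) => S0; rewrite -finset.subset0 -S0.
split; first exact: unif_Delta.
move=> th' jmax imax y /DeltaP[_ yS] z /yS zS.
have imaxS := Delta_unif_imax S0 (reducedZ_sub_Zstar i th) jmax imax.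
have FF : F th \subset F th'.
  by apply: imax_hatL_sub imaxS FS _; rewrite hatLE asboolT.
have /reducedZP[zD [K [KXi zK]]] := zS.
have [_ [_ KE]] := KXi.
apply: (bigcapFP _ _ _ zK); rewrite -KE; split.
  by split=> //; exact: imax_thS imaxS.
apply: imax_thS imaxS.
  by apply/finset.set0Pn; exists z; apply/finset.setIP.
apply/fintype.subsetP => z' /finset.setIP[z'D z'K]; apply/reducedZP.
by split=> //; exists K.
Qed.

(** The optimality premises are contradictory: they would make [lowerZstar] a max set at [th'], with
    [th'] in [ThetaI], and [Xi_above] applied to [F th] would show that [Xi] is nonempty. *)
Lemma full_point_lowerZstar i th : ~ reduced u F i th ->
  F th \subset argmin_in (u th i) Zs ->
  full_point (hatL i th) i (unif (lowerZstar u F i th)).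
Proof.
move=> nred Fmin; have FD := F_sub_lowerZstar Fmin.
have hatLD : hatL i th = Delta (lowerZstar u F i th).
  by rewrite hatLE asboolF// Delta_lowerZstar.
have D0 : lowerZstar u F i th != finset.set0.
  by apply: contraNneq (F_neq0 th) => D0; rewrite -finset.subset0 -D0.
split; first by rewrite hatLD; exact: unif_Delta.
move=> th' jmax imax; exfalso; rewrite hatLD in imax.
have imaxD := Delta_unif_imax D0 (finset.subsetIl _ _) jmax imax.
have FF : F th \subset F th' by apply: imax_hatL_sub imaxD FD _; rewrite hatLD.
apply: nred; split=> //; split; last by exists th'.
have [||K [KXi _]] := @Xi_above _ _ _ _ u F i th (F th) (F_neq0 th) FD
    (F_neq0 th) FD.
- by exists th'; split=> //; split=> //; exact: imax_thS imaxD.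
- by move=> th1 [].
- by exists K.
Qed.

(** A lottery with full support on [Zs] exists strictly inside the lower set. Its optimality at
    [th'] forces all agents to be indifferent over [Zs]. *)
Lemma full_point_interior i th : ~~ (F th \subset argmin_in (u th i) Zs) ->
  exists y0, full_point (hatL i th) i y0.
Proof.
move=> /subsetPn[z1 z1F z1min]; set A := EU u i th (unif (F th)).
have FZ := F_sub_Zstar u F th.
have z1Z : z1 \in Zs by exact: (fintype.subsetP FZ).
have Z0 : Zs != finset.set0 by apply/finset.set0Pn; exists z1.
have hatLE' : hatL i th = Delta Zs `&` lowerY u i th (unif (F th)).
  rewrite hatLE asboolF// => -[Fmin _].
  by move/negP: z1min; apply; exact: (fintype.subsetP Fmin).
(* If every point of [Zs] paid at least [A], the average [A] over [F th] would force [z1] to pay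
   [A], making it a minimizer. *)
have [z0 z0Z z0A] : exists2 z0, z0 \in Zs & u th i z0 < A.
  apply: contrapT => /forall2NP h; move/negP: z1min; apply.
  have uA z : z \in Zs -> A <= u th i z.
    by move=> zZ; have [//|/negP] := h z; rewrite -leNgt.
  apply/argminP; split=> // z zZ; apply: le_trans (uA _ zZ).
  rewrite (expect_min_const (unif_lottery (F_neq0 th)) _ (lexx A)) ?unif_gt0//.
  by move=> t; rewrite unif_gt0 => /(fintype.subsetP FZ); exact: uA.
have A0 : 0 < A - u th i z0 by rewrite subr_gt0.
have [t [t0 t1 tA]] := small_step (EU u i th (unif Zs) - u th i z0) A0.
pose y0 z : R := (1 - t) * unif [set z0]%SET z + t * unif Zs z.
have t01 : 0 <= t <= 1 by rewrite ltW.
have y0Z : Delta Zs y0.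
  by apply: Delta_mix => //; [exact: unif1_Delta|exact: unif_Delta].
have y0A : EU u i th y0 < A.
  rewrite EUE expect_mix expect_unif1; move: tA; rewrite -EUE.
  by rewrite ltrBrDr; apply: le_lt_trans; lra.
have y0_gt0 z : z \in Zs -> 0 < y0 z.
  move=> zZ; apply: ltr_wpDl; last by rewrite mulr_gt0// unif_gt0.
  rewrite mulr_ge0 ?subr_ge0//; have := @unif1_Delta R _ _ _ z0Z.
  by move=> [[]].
exists y0; split.
  by rewrite hatLE'; split=> //; split; [case: y0Z|exact: ltW].
move=> th' jmax imax y /hatL_Zstar/DeltaP[_ yZ] z /yZ; apply/fintype.subsetP.
apply: Zstar_indifferent => j z2 z3 z2Z z3Z.
have [->|ji] := eqVneq j i; last by apply: jmax => //; exact: y0_gt0.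
(* The slack of [y0] at [th] leaves room for a small step towards [z4], which cannot improve on [y0]
   at [th']. *)
have u_le z4 : z4 \in Zs -> u th' i z4 <= EU u i th' y0.
  move=> z4Z; have Ay0 : 0 < A - EU u i th y0 by rewrite subr_gt0.
  have [s [s0 s1 sA]] := small_step (u th i z4 - EU u i th y0) Ay0.
  pose y1 z' : R := (1 - s) * y0 z' + s * unif [set z4]%SET z'.
  have y1Z : Delta Zs y1.
    by apply: Delta_mix => //; [exact: unif1_Delta|rewrite ltW].
  have /imax : hatL i th y1.
    rewrite hatLE'; split=> //; split; first by case: y1Z.
    rewrite EUE expect_mix expect_unif1 -EUE -/A; move: sA.
    by rewrite ltrBrDr => /ltW; apply: le_trans; lra.
  rewrite EUE expect_mix expect_unif1 -!EUE => h.
  rewrite -(ler_pM2l s0); move: h; lra.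
have ly0 := y0Z.1.
rewrite (@expect_max_const _ _ y0 (u th' i) (EU u i th' y0) ly0 _ _ z3)//.
- exact: u_le.
- by move=> t' ty0; apply: u_le; have /DeltaP[_] := y0Z; exact.
- exact: y0_gt0.
Qed.

Lemma hatL_full_point i th : exists y0, full_point (hatL i th) i y0.
Proof.
have [red|nred] := pselect (reduced u F i th).
  by exists (unif (reducedZ u F i th)); exact: full_point_reduced.
have [Fmin|Fmin] := boolP (F th \subset argmin_in (u th i) Zs).
  by exists (unif (lowerZstar u F i th)); exact: full_point_lowerZstar.
exact: full_point_interior.
Qed.

End Monotone.
End HatL.

Lemma third_agent n (i j : 'I_n) :
  (3 <= n)%N -> exists k : 'I_n, k != i /\ k != j.
Proof.
move=> n3; have : (0 < #|~: [set i; j]%SET|)%N.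
  rewrite -(ltn_add2l #|[set i; j]%SET|) cardsC card_ord addn0 cards2.
  by apply: leq_trans n3; case: (i != j).
rewrite card_gt0 => /finset.set0Pn[k]; rewrite !inE negb_or => /andP[ki kj].
by exists k.
Qed.

(** With [a] within [w] of the supremum [s], putting weight [w] on [f] loses at most
    [w * (1 + (s - f))]. *)
Lemma mix_lower {R : realFieldType} (w s a f e : R) :
  0 < w -> w <= 1 -> s <= a + w ->
  w * (1 + (s - f)) <= e -> s - e <= (1 - w) * a + w * f.
Proof.
move=> w0 w1 sa we.
have h1 : (1 - w) * (s - w) <= (1 - w) * a.
  by rewrite ler_wpM2l ?subr_ge0// lerBlDr.
have h2 : 0 <= w * w by rewrite mulr_ge0// ltW.
lra.
Qed.

Lemma mix_max {R : realFieldType} (w s a f : R) : 0 < w -> w <= 1 -> a <= s ->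
  (1 - w) * a + w * f = s -> s <= f.
Proof.
move=> w0 w1 sa ws; rewrite -(ler_pM2l w0).
have : (1 - w) * a <= (1 - w) * s by rewrite ler_wpM2l ?subr_ge0.
lra.
Qed.

(** * The canonical mechanism and its equilibria *)

Section Mechanism.
Context {R : realType} {n : nat} {Theta : countType} {Z : finType}.
Variables (u : Theta -> 'I_n -> Z -> R) (F : Theta -> {set Z}).
Hypothesis F_neq0 : forall th, F th != finset.set0.
Hypothesis mono : hat_uniform_monotonicity u F.
Hypothesis n3 : (3 <= n)%N.
Local Notation Zs := (Zstar u F).
Local Notation message := (Theta * nat)%type.
Local Notation profile := (forall i : 'I_n, message).
Implicit Types (i j : 'I_n) (th : Theta) (y : Z -> R) (m : profile)
  (o : option Theta).

Let n_gt0 : (0 < n)%N := leq_trans (isT : 0 < 3)%N n3.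

Lemma Zstar_neq0 th : Zs != finset.set0.
Proof.
apply: contraNneq (F_neq0 th) => Z0.
by rewrite -finset.subset0 -Z0; exact: F_sub_Zstar.
Qed.

Definition agree m i th := forall j, j != i -> m j = (th, 0%N).

Definition others m i : option Theta :=
  if pselect (exists th, agree m i th) is left h then Some (sval (cid h))
  else None.

(** Some agent other than [i] exists, so the agreed state is unique and the choice in [others] is
    immaterial. *)
Lemma othersP m i th : others m i = Some th <-> agree m i th.
Proof.
rewrite /others; case: pselect => [h|nh]; last first.
  by split=> // ag; case: nh; exists th.
have ag' := svalP (cid h); split=> [[<-//]|ag].
have [j [ji _]] := third_agent i i n3.
by congr Some; have := ag' j ji; rewrite (ag j ji) => -[].
Qed.

Lemma others_eq m m' i :
  (forall j, j != i -> m j = m' j) -> others m i = others m' i.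
Proof.
move=> mm'; case E: (others m i) => [th|].
  by apply/esym/othersP => j ji; rewrite -mm'//; move/othersP: E; exact.
case E': (others m' i) => [th|//].
suff : others m i = Some th by rewrite E.
by apply/othersP => j ji; rewrite mm'//; move/othersP: E'; exact.
Qed.

(** A third agent takes part in both agreements, so the two states coincide. *)
Lemma others_consensus m i j th : i != j -> others m i = Some th ->
  others m j -> forall k, m k = (th, 0%N).
Proof.
move=> ij /othersP mi; case E: (others m j) => [th'|//] _ k.
move/othersP: E => mj; have [l [li lj]] := third_agent i j n3.
have [ki|ki] := eqVneq k i; last exact: mi.
rewrite ki mj//; congr (_, _); have := mi l li; rewrite (mj l lj).
by case.
Qed.

Definition region i o : set (Z -> R) :=
  if o is Some th then hatL u F i th else Delta Zs.

Definition full i o : Z -> R := xget (unif Zs) (full_point u F (region i o) i).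

Definition near i o th k : Z -> R := xget (unif Zs)
  [set y | region i o y /\ forall y', region i o y' ->
     EU u i th y' <= EU u i th y + k.+1%:R^-1].

(** The reported integer sets both the precision of the optimization and the weight of the full
    point, which is never zero. *)
Definition play i o (x : message) : Z -> R := fun z =>
  (1 - x.2.+1%:R^-1) * near i o x.1 x.2 z + x.2.+1%:R^-1 * full i o z.

Lemma region_Zstar i o y : region i o y -> Delta Zs y.
Proof. by case: o => [th /hatL_Zstar|]. Qed.

Lemma region_mix i o y y' t : region i o y -> region i o y' -> 0 <= t <= 1 ->
  region i o (fun z => (1 - t) * y z + t * y' z).
Proof. by case: o => [th|]; [exact: hatL_mix|exact: Delta_mix]. Qed.

Lemma fullP i o : Zs != finset.set0 -> full_point u F (region i o) i (full i o).
Proof.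
move=> Z0; apply: (@xgetPex _ (unif Zs) (full_point u F (region i o) i)).
case: o => [th|]; first exact: hatL_full_point.
by exists (unif Zs); exact: full_point_Zstar.
Qed.

Definition best i o th : R := sup [set EU u i th y | y in region i o].

Lemma region_has_sup i o th : Zs != finset.set0 ->
  has_sup [set EU u i th y | y in region i o].
Proof.
move=> Z0; split.
  by exists (EU u i th (full i o)), (full i o) => //; case: (fullP i o Z0).
exists (\sum_z `|u th i z|) => _ [y /region_Zstar[ly _] <-].
apply: expect_le => // z _; rewrite (bigD1 z)//=.
apply: le_trans (ler_norm _) _; rewrite lerDl; exact: sumr_ge0.
Qed.

Lemma best_ge i o th y : region i o y -> EU u i th y <= best i o th.
Proof.
move=> yL; apply: sup_upper_bound; last by exists y.
apply: region_has_sup; have [z zy] := lottery_supp (region_Zstar yL).1.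
by apply/finset.set0Pn; exists z; have /DeltaP[_] := region_Zstar yL; exact.
Qed.

Lemma nearP i o th k : Zs != finset.set0 -> region i o (near i o th k) /\
  best i o th <= EU u i th (near i o th k) + k.+1%:R^-1.
Proof.
move=> Z0; have hs := region_has_sup i o th Z0.
have e0 : 0 < k.+1%:R^-1 :> R by rewrite invr_gt0.
have [|nL nmax] := @xgetPex _ (unif Zs) [set y | region i o y /\
    forall y', region i o y' -> EU u i th y' <= EU u i th y + k.+1%:R^-1].
  have [_ [y yL <-] ltb] := sup_adherent e0 hs.
  exists y; split=> // y' /(best_ge th) y'b.
  by apply: (le_trans y'b); rewrite -lerBlDr; exact: ltW.
split=> //; apply: ge_sup; first exact: hs.1.
by move=> _ [y yL <-]; exact: nmax.
Qed.

Lemma weight01 k : 0 <= (k.+1%:R^-1 : R) <= 1.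
Proof. by rewrite invr_ge0 ler0n/= invf_le1 ?ler1n. Qed.

Lemma play_region i o x : region i o (play i o x).
Proof.
have Z0 := Zstar_neq0 x.1; apply: region_mix; last exact: weight01.
- by case: (nearP i o x.1 x.2 Z0).
- by case: (fullP i o Z0).
Qed.

Lemma play_limit i o th e : 0 < e -> exists N, forall k, (N <= k)%N ->
  best i o th - e <= EU u i th (play i o (th, k)).
Proof.
move=> e0; have Z0 := Zstar_neq0 th.
set s := best i o th; set f := EU u i th (full i o).
have fs : f <= s by apply: best_ge; case: (fullP i o Z0).
pose C := 1 + (s - f).
have C0 : 0 < C by rewrite ltr_pwDl// subr_ge0.
(* Beyond this bound the loss [k.+1%:R^-1 * C] allowed by [mix_lower] is at most [e]. *)
exists (Num.bound (C / e)) => k Nk.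
have w0 : 0 < k.+1%:R^-1 :> R by rewrite invr_gt0.
have /andP[_ w1] := weight01 k.
have wC : k.+1%:R^-1 * C <= e.
  rewrite mulrC ler_pdivrMr// mulrC -ler_pdivrMr//.
  apply: le_trans (ltW (archi_boundP _)) _; first by rewrite divr_ge0// ltW.
  by rewrite ler_nat (leq_trans Nk).
have [_ snear] := nearP i o th k Z0.
rewrite EUE expect_mix/= -!EUE -/f.
exact: mix_lower.
Qed.

Lemma play_best_full i o x th :
  EU u i th (play i o x) = best i o th -> EU u i th (full i o) = best i o th.
Proof.
have Z0 := Zstar_neq0 x.1.
have nb : EU u i th (near i o x.1 x.2) <= best i o th.
  by apply: best_ge; case: (nearP i o x.1 x.2 Z0).
have fb : EU u i th (full i o) <= best i o th.
  by apply: best_ge; case: (fullP i o Z0).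
have w0 : 0 < x.2.+1%:R^-1 :> R by rewrite invr_gt0.
have /andP[_ w1] := weight01 x.2.
rewrite EUE expect_mix -!EUE => eb; apply/eqP; rewrite eq_le fb/=.
exact: mix_max eb.
Qed.

Lemma full_supp_play i o x z : 0 < full i o z -> 0 < play i o x z.
Proof.
move=> fz; have Z0 := Zstar_neq0 x.1; have /andP[_ w1] := weight01 x.2.
apply: ltr_wpDl; last by rewrite mulr_gt0// invr_gt0.
rewrite mulr_ge0 ?subr_ge0//.
by have [/region_Zstar[[]]] := nearP i o x.1 x.2 Z0.
Qed.

(** Outside a consensus, at most one agent faces unanimous opponents, so the first branch singles
    out the unilateral deviator. *)
Definition winner m : 'I_n :=
  if [pick i | others m i] is Some i then i
  else arg_max (Ordinal n_gt0) xpredT (fun i => (m i).2).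

Definition outcome m : Z -> R :=
  if pselect (exists th, forall i, m i = (th, 0%N)) is left h
  then unif (F (sval (cid h)))
  else play (winner m) (others m (winner m)) (m (winner m)).

Lemma outcome_consensus m th :
  (forall i, m i = (th, 0%N)) -> outcome m = unif (F th).
Proof.
move=> mth; rewrite /outcome; case: pselect => [h|[]]; last by exists th.
by have := svalP (cid h) (Ordinal n_gt0); rewrite mth => -[<-].
Qed.

Lemma outcome_dissent m : ~ (exists th, forall i, m i = (th, 0%N)) ->
  outcome m = play (winner m) (others m (winner m)) (m (winner m)) /\
  forall i, i != winner m -> others m i = None.
Proof.
move=> nc; split; first by rewrite /outcome; case: pselect.
move=> i; case E: (others m i) => [th|//] iw; exfalso; apply: nc; exists th.
apply: (others_consensus iw E); rewrite /winner; case: pickP => [//|/(_ i)].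
by rewrite E.
Qed.

(** Holds for every agent, winner or not, and so bounds each payoff by the corresponding [best]. *)
Lemma outcome_region m i : region i (others m i) (outcome m).
Proof.
have [[th mth]|/outcome_dissent[-> dis]] :=
    pselect (exists th, forall i, m i = (th, 0%N)).
  have -> : others m i = Some th by apply/othersP.
  by rewrite (outcome_consensus mth); exact: hatL_unif.
have [->|iw] := eqVneq i (winner m); first exact: play_region.
by rewrite dis//; apply: region_Zstar; exact: play_region.
Qed.

(** The positive integer of [i] rules out a consensus and any agreement that includes [i]; hence no
    other agent can win. *)
Lemma outcome_winner m i : (0 < (m i).2)%N ->
  (forall j, j != i -> ((m j).2 < (m i).2)%N) ->
  outcome m = play i (others m i) (m i).
Proof.
move=> mi0 mimax.
have nc : ~ exists th, forall i, m i = (th, 0%N).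
  by move=> [th mth]; move: mi0; rewrite mth.
have [-> _] := outcome_dissent nc.
suff -> : winner m = i by [].
rewrite /winner; case: pickP => [w|_].
  case E: (others m w) => [th|//] _; apply/eqP; apply: contraTT mi0 => wi.
  by move/othersP: E => ->//; rewrite eq_sym.
case: arg_maxnP => // w _ wmax; apply/eqP; apply: contraT => wi.
have wm : ((m i).2 <= (m w).2)%N := wmax i isT.
by have := mimax w wi; rewrite ltnNge wm.
Qed.

Lemma outcome_lottery m : is_lottery (outcome m).
Proof. by have [] := region_Zstar (outcome_region m (Ordinal n_gt0)). Qed.

Definition canonical : mechanism R n Z :=
  @Mechanism R n Z (fun=> message : countType) outcome outcome_lottery.

Lemma canonical_PNE th :
  PNE u canonical th (fun=> (th, 0%N) : message).
Proof.
move=> i m' m'E.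
have -> : outc canonical (fun=> (th, 0%N)) = unif (F th).
  exact: outcome_consensus.
have := outcome_region m' i.
have -> : others m' i = Some th by apply/othersP => j ji; rewrite m'E.
by move=> /(hatL_lowerY F_neq0)[].
Qed.

Lemma canonical_MNE_best th (lam : forall i : 'I_n, msg canonical i -> R) m i :
  MNE u canonical th lam -> 0 < prob lam m ->
  EU u i th (outcome m) = best i (others m i) th.
Proof.
move=> [lamP lamBR].
apply: (@best_response_limit _ _ _ canonical lam i (fun k => (th, k.+1))
  (u th i) (fun m => best i (others m i) th)) => //.
- move=> k; apply: lamBR; first exact: update_dirac_mixed.
  by move=> j ji; rewrite update_out.
- by move=> m'; apply: best_ge; exact: outcome_region.
- move=> m' e e0; have [N NP] := play_limit i (others m' i) th e0.
  (* The sum bounds every integer in [m'], so the report [k.+1] is strictly the highest. *)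
  exists (N + \sum_j (m' j).2)%N => k Nk.
  pose m'' : profile := @deviate R n Z canonical m' i (th, k.+1).
  have m''i : m'' i = (th, k.+1).
      exact: (@deviate_in R n Z canonical m' i (th, k.+1)).
  have m''j j : j != i -> m'' j = m' j.
      by move=> ji; exact: (@deviate_out R n Z canonical m' i (th, k.+1)).
  have -> : outc canonical (@deviate R n Z canonical m' i (th, k.+1)) =
      play i (others m' i) (th, k.+1).
    rewrite -[LHS]/(outcome m'') -(@others_eq m'')// -m''i.
    apply: outcome_winner; rewrite m''i//.
    move=> j ji; rewrite m''j// ltnS; apply: leq_trans Nk.
    by rewrite (bigD1 j)//= addnCA leq_addr.
  apply: NP; apply: leq_trans (leqnSn k); apply: leq_trans Nk.
  exact: leq_addr.
Qed.

Lemma canonical_MNE_sound th (lam : forall i : 'I_n, msg canonical i -> R) z :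
  MNE u canonical th lam -> supp (glot lam) z -> z \in F th.
Proof.
move=> lamN zlam; have [lamP _] := lamN.
have /glot_gt0-/(_ lamP)[m [pm mz]] := zlam.
have bestm i := @canonical_MNE_best th lam m i lamN pm.
have [[th' mth]|nc] := pselect (exists th, forall i, m i = (th, 0%N)).
  have mE := outcome_consensus mth.
  have /fintype.subsetP : F th' \subset F th.
    (* At [th] each agent already attains her supremum over [hatL i th'] with [unif (F th')], which
       is the premise of monotonicity. *)
    apply: mono => i y Ly; split; first by have [] := hatL_Zstar Ly.
    have := bestm i; rewrite mE => ->.
    have -> : others m i = Some th' by apply/othersP => j _; exact: mth.
    exact: (@best_ge i (Some th')).
  by apply; move: mz; rewrite [outc _ _]mE unif_gt0.
have [mE dis] := outcome_dissent nc.
set w := winner m in mE dis.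
have Lm := outcome_region m w.
have Z0 := Zstar_neq0 (m w).1.
have [_] := fullP w (others m w) Z0.
move=> /(_ th); apply; [| |exact: Lm|exact: mz].
(* Any agent but the winner could have obtained every lottery on [Zs], so the support of the
   outcome, which includes that of the full point, is optimal for her. *)
- move=> j jw z1 z2 z1f z2Z.
  apply: (@Delta_max_const _ _ Zs (outcome m)) => //.
  + exact: region_Zstar Lm.
  + move=> y yZ; have := bestm j; rewrite dis// EUE => ->.
    exact: (@best_ge j None).
  + by rewrite mE; exact: full_supp_play.
(* The winning mixture attains the supremum, hence so does the full point, which has positive weight
   in it. *)
- move=> y yL; have := bestm w; rewrite mE => /play_best_full ->.
  exact: best_ge.
Qed.

Lemma monotone_implementable : mixed_B_implementable u F.
Proof.
exists canonical => th z.
have F_PNE : z \in F th ->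
    exists m, PNE u canonical th m /\ supp (outc canonical m) z.
  move=> zF; exists (fun=> (th, 0%N)); split; first exact: canonical_PNE.
  by rewrite /supp/= (@outcome_consensus _ th)// unif_gt0.
have PNE_F m : PNE u canonical th m -> supp (outc canonical m) z ->
    exists lam, MNE u canonical th lam /\ supp (glot lam) z.
  by move=> /PNE_MNE[lam [lamN lamz]] /lamz; exists lam.
split; split=> //.
- by move=> /F_PNE[m [mN mz]]; exact: PNE_F mN mz.
- by move=> [lam [lamN zlam]]; exact: canonical_MNE_sound zlam.
- move=> [m [mN mz]]; have [lam [lamN zlam]] := PNE_F m mN mz.
  exact: canonical_MNE_sound zlam.
Qed.

End Mechanism.

Theorem theorem6 (R : realType) (n : nat) (Theta : countType) (Z : finType)
  (u : Theta -> 'I_n -> Z -> R) (F : Theta -> {set Z}) :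
  (3 <= n)%N ->
  (forall th, F th != finset.set0) ->
  (mixed_A_implementable u F <-> mixed_B_implementable u F) /\
  (mixed_B_implementable u F <-> hat_uniform_monotonicity u F).
Proof.
move=> n3 F0.
have BA : mixed_B_implementable u F -> mixed_A_implementable u F.
  by move=> [M MB]; exists M => th z; case: (MB th z).
have AM : mixed_A_implementable u F -> hat_uniform_monotonicity u F.
  by move=> [M MA]; exact: implementable_monotone MA.
have MB : hat_uniform_monotonicity u F -> mixed_B_implementable u F.
  by move=> mono; exact: monotone_implementable.
by split; split=> // h; [exact/MB/AM|exact/AM/BA].
Qed.
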